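(* Let $p$ be an odd prime and let $\mathcal{G}$ be the GGS-group with constant defining vector $(1,\dots,1)\in\mathbb{F}_p^{p-1}$. Then $\mathcal{G}$ is not a branch group.
   Context: Fix an odd prime $p$. Let $X=\{1,\dots,p\}$ and let $T$ be the regular rooted tree whose vertices are the words in the free monoid $X^*$, with $u,v$ joined by an edge if $v=ux$ or $u=vx$ for some $x\in X$. $L_n$ is the set of words of length $n$. $\operatorname{Aut} T$ is the group of automorphisms of $T$ and $\operatorname{st}(n)$ is the stabilizer of all vertices of $L_n$; for $G\le \operatorname{Aut}T$, $\operatorname{st}_G(n)=G\cap\operatorname{st}(n)$. For $g$ fixing a vertex $v$, $g_v\in\operatorname{Aut}T$ denotes the restriction of $g$ to the subtree rooted at $v$ (identified with $T$), i.e. $g(vw)=v\,g_v(w)$; $\psi_n:\operatorname{st}(n)\to \operatorname{Aut}T\times\overset{p^n}{\cdots}\times\operatorname{Aut}T$ is the isomorphism $g\mapsto(g_v)_{v\in L_n}$, and $\psi=\psi_1$. The GGS-group with constant defining vector is $\mathcal{G}=\langle a,b\rangle\le\operatorname{Aut}T$, where $a$ is the rooted automorphism given by $a(xv)=\sigma(x)v$ for $x\in X$, $v\in X^*$, with $\sigma=(1\;2\;\dots\;p)$, and $b\in\operatorname{st}(1)$ is recursively defined by $\psi(b)=(a,a,\dots,a,b)$. For $G\le\operatorname{Aut}T$ and $v\in L_n$, $\operatorname{rst}_G(v)$ is the subgroup of all $g\in\operatorname{st}_G(n)$ such that all coordinates of $\psi_n(g)$ are $1$ except possibly the one at position $v$,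 and $\operatorname{rst}_G(n)=\prod_{v\in L_n}\operatorname{rst}_G(v)$. A subgroup $G\le\operatorname{Aut}T$ is a branch group if it acts transitively on every level $L_n$ and $|G:\operatorname{rst}_G(n)|<\infty$ for all $n$. *)

(* Defs.v *)
From HB Require Import structures.
From mathcomp Require Import all_boot.
From mathcomp Require Import boolp classical_sets cardinality.

Set Implicit Arguments.
Unset Strict Implicit.
Unset Printing Implicit Defensive.

Local Open Scope classical_set_scope.
Local Open Scope group_scope.

Record subgroup (gT : groupType) := Subgroup {
  sg_set :> set gT;
  sg_closed : group_closed [in sg_set] }.

Section Subgroups.
Variable gT : groupType.
Implicit Types (S G H : set gT).

Definition gen_set S := smallest [set H | group_closed [in H]] S.

Lemma gen_set_closed S : group_closed [in gen_set S].
Proof.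
split; first by rewrite inE => H [[H1 _] _]; rewrite inE in H1.
move=> x y; rewrite !inE => Sx Sy H HS; have [[_ HB] _] := HS.
by move: (HB x y); rewrite !inE; apply; [exact: Sx | exact: Sy].
Qed.

Definition generated S : subgroup gT := Subgroup (@gen_set_closed S).

(* Finitely many left cosets g H with g in G. *)
Definition finite_index G H :=
  finite_set [set C | exists2 g, G g & C = [set g * h | h in H]].

End Subgroups.

(* The letters 1, ..., p are represented by 0, ..., p - 1 : 'I_p. *)
Definition word p := seq 'I_p.

Section Tree.
Variable p : nat.
Implicit Types (u v w : word p) (f g : word p -> word p).

Definition adjacent u v := [exists x, (v == rcons u x) || (u == rcons v x)].

(* The root has degree p and the other vertices have degree p + 1, so fixing the
   root is automatic when p > 0. *)
Definition is_tree_aut f :=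
  [/\ bijective f, f [::] = [::] & forall u v, adjacent (f u) (f v) = adjacent u v].

Record autT := AutT { aut_fun :> word p -> word p; autP : is_tree_aut aut_fun }.

Lemma autT_eq (g h : autT) : (forall w, g w = h w) -> g = h.
Proof.
case: g h => [g gP] [h hP] /= /funext gh; subst h.
by congr AutT; exact: Prop_irrelevance.
Qed.

Definition extends f := forall u x, exists y, f (rcons u x) = rcons (f u) y.

Lemma is_tree_autI f g : cancel f g -> cancel g f -> f [::] = [::] ->
  extends f -> extends g -> is_tree_aut f.
Proof.
move=> fK gK f0 fe ge; split => //; first by exists g.
have adjP h : extends h -> forall u v, adjacent u v -> adjacent (h u) (h v).
  move=> he u v /existsP[x /orP[]/eqP->]; apply/existsP.
    by have [y ->] := he u x; exists y; rewrite eqxx.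
  by have [y ->] := he v x; exists y; rewrite eqxx orbT.
move=> u v; apply/idP/idP; last exact: adjP.
by move/(adjP _ ge); rewrite !fK.
Qed.

Lemma aut_extends f : is_tree_aut f -> extends f.
Proof.
move=> [fb f0 fadj]; elim/last_ind => [|u z IHu] x.
  have : adjacent (f [::]) (f [:: x]).
    by rewrite fadj; apply/existsP; exists x; rewrite eqxx.
  rewrite f0 => /existsP[y /orP[/eqP e|]]; first by exists y.
  by rewrite eq_sym -size_eq0 size_rcons.
have : adjacent (f (rcons u z)) (f (rcons (rcons u z) x)).
  by rewrite fadj; apply/existsP; exists x; rewrite eqxx.
move=> /existsP[y /orP[/eqP->|/eqP e]]; first by exists y.
have [t et] := IHu z; move: e; rewrite et => /rcons_inj[/(bij_inj fb)/(congr1 size)].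
by rewrite !size_rcons => /eqP; rewrite eqn_leq [_.+2 <= _]ltnNge leqnSn andbF.
Qed.

Lemma aut_size f u : is_tree_aut f -> size (f u) = size u.
Proof.
move=> fP; have [_ f0 _] := fP; elim/last_ind: u => [|u x IHu]; first by rewrite f0.
by have [y ->] := aut_extends fP u x; rewrite !size_rcons IHu.
Qed.

Lemma aut_cat f u v : is_tree_aut f -> f (u ++ v) = f u ++ drop (size u) (f (u ++ v)).
Proof.
move=> fP; elim/last_ind: v => [|v x IHv].
  by rewrite cats0 drop_oversize ?cats0 ?aut_size.
rewrite -rcons_cat; have [y ->] := aut_extends fP (u ++ v) x.
by rewrite drop_rcons; [rewrite -rcons_cat -IHv|rewrite aut_size// size_cat leq_addr].
Qed.

Lemma id_is_aut : is_tree_aut id.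
Proof. by split=> //; exists id. Qed.

Lemma comp_is_aut f g : is_tree_aut f -> is_tree_aut g -> is_tree_aut (f \o g).
Proof.
move=> [fb f0 fadj] [gb g0 gadj]; split => [||u v /=].
- exact: bij_comp.
- by rewrite /= g0 f0.
- by rewrite fadj gadj.
Qed.

Lemma aut_surj (g : autT) v : exists u, g u == v.
Proof. by have [[h _ hK] _ _] := autP g; exists (h v); rewrite hK. Qed.

Definition inv_fun (g : autT) v := xchoose (aut_surj g v).

Lemma inv_funK (g : autT) : cancel (inv_fun g) g.
Proof. by move=> v; apply/eqP; exact: (xchooseP (aut_surj g v)). Qed.

Lemma fun_invK (g : autT) : cancel g (inv_fun g).
Proof.
have [gb _ _] := autP g.
by move=> v; apply: (bij_inj gb); rewrite inv_funK.
Qed.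

Lemma inv_is_aut (g : autT) : is_tree_aut (inv_fun g).
Proof.
have [_ g0 gadj] := autP g; split.
- by exists g; [exact: inv_funK | exact: fun_invK].
- by rewrite -{1}g0 fun_invK.
- by move=> u v; rewrite -gadj !inv_funK.
Qed.

Definition aut_one := AutT id_is_aut.
Definition aut_mul (g h : autT) := AutT (comp_is_aut (autP g) (autP h)).
Definition aut_inv (g : autT) := AutT (inv_is_aut g).

Fact aut_mulA : associative aut_mul.
Proof. by move=> f g h; apply: autT_eq. Qed.
Fact aut_mul1 : left_id aut_one aut_mul.
Proof. by move=> g; apply: autT_eq. Qed.
Fact aut_mulr1 : right_id aut_one aut_mul.
Proof. by move=> g; apply: autT_eq. Qed.
Fact aut_mulV : left_inverse aut_one aut_inv aut_mul.
Proof. by move=> g; apply: autT_eq => w /=; rewrite fun_invK. Qed.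
Fact aut_mulrV : right_inverse aut_one aut_inv aut_mul.
Proof. by move=> g; apply: autT_eq => w /=; rewrite inv_funK. Qed.

HB.instance Definition _ := gen_eqMixin autT.
HB.instance Definition _ := gen_choiceMixin autT.
HB.instance Definition _ :=
  isGroup.Build autT aut_mulA aut_mul1 aut_mulr1 aut_mulV aut_mulrV.

Lemma aut_mulE (g h : autT) w : (g * h) w = g (h w).
Proof. by []. Qed.

(* The section is defined at every vertex by g (v ++ w) = g v ++ section g v w;
   when g fixes v it is the restriction of g to the subtree rooted at v. *)
Definition section_fun f v w := drop (size v) (f (v ++ w)).

Lemma section_is_aut (g : autT) v : is_tree_aut (section_fun g v).
Proof.
have secE (h : autT) u w : h (u ++ w) = h u ++ section_fun h u w.
  exact: aut_cat (autP h).
have ext (h : autT) u : extends (section_fun h u).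
  move=> w x; rewrite /section_fun -rcons_cat.
  have [y ->] := aut_extends (autP h) (u ++ w) x; exists y.
  by rewrite drop_rcons// (aut_size _ (autP h)) size_cat leq_addr.
have secK (h k : autT) u : cancel h k ->
    cancel (section_fun h u) (section_fun k (h u)).
  move=> hK w; rewrite [LHS]/section_fun -secE hK.
  by rewrite (aut_size _ (autP h)) drop_size_cat.
apply: (@is_tree_autI _ (section_fun (g^-1) (g v))).
- exact/secK/fun_invK.
- by rewrite -{2}[v](fun_invK g); exact/secK/inv_funK.
- by rewrite /section_fun cats0 drop_oversize// (aut_size _ (autP g)).
- exact: ext.
- exact: ext.
Qed.

Definition section (g : autT) v := AutT (section_is_aut g v).

Lemma sectionE (g : autT) v w : g v = v -> g (v ++ w) = v ++ section g v w.
Proof. by move=> gv; rewrite -{2}gv; exact: aut_cat (autP g). Qed.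

(* The level L_n is the type n.-tuple 'I_p of words of length n. *)

Definition st n : set autT :=
  [set g : autT | forall v : n.-tuple 'I_p, g v = v :> word p].

Definition psi n (g : autT) : n.-tuple 'I_p -> autT := fun v : n.-tuple 'I_p => section g v.

Definition rst (G : subgroup autT) n (v : n.-tuple 'I_p) : set autT :=
  [set g | (G `&` st n) g /\ forall u : n.-tuple 'I_p, u != v -> psi g u = 1].

(* The factors commute pairwise, so their order in the product is irrelevant. *)
Definition rst_level (G : subgroup autT) n : set autT :=
  [set \prod_(v : n.-tuple 'I_p) h v | h in
     [set h : n.-tuple 'I_p -> autT | forall v : n.-tuple 'I_p, rst G v (h v)]].

Definition level_transitive (G : subgroup autT) n :=
  forall u v : n.-tuple 'I_p, exists2 g, sg_set G g & g u = v :> word p.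

Definition is_branch (G : subgroup autT) :=
  (forall n, level_transitive G n) /\ (forall n, finite_index G (rst_level G n)).

(* On 'I_p the p-cycle (1 2 ... p) is the cyclic successor ordS. *)
Definition rooted_fun (s : 'I_p -> 'I_p) w : word p :=
  if w is x :: v then s x :: v else [::].

Lemma rooted_is_aut s t : cancel s t -> cancel t s -> is_tree_aut (rooted_fun s).
Proof.
move=> sK tK; have ext r : extends (rooted_fun r).
  by move=> [|y u] x /=; [exists (r x) | exists x].
by apply: (@is_tree_autI _ (rooted_fun t)) => // -[|x v] //=; rewrite ?sK ?tK.
Qed.

Definition ggs_a := AutT (rooted_is_aut (@ordSK p) (@ord_predK p)).

Fixpoint directed_fun f w : word p :=
  if w is x :: v then
    x :: (if x.+1 == p then directed_fun f v else f v)
  else [::].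

Lemma directed_is_aut (g : autT) : is_tree_aut (directed_fun g).
Proof.
have ext (h : autT) : extends (directed_fun h).
  move=> u x; elim: u => [|z u [y IHu]] /=.
    by exists x; case: ifP => // _; have [_ -> _] := autP h.
  case: ifP => _; first by exists y; rewrite IHu.
  by have [t ->] := aut_extends (autP h) u x; exists t.
have K (h k : autT) : cancel h k -> cancel (directed_fun h) (directed_fun k).
  by move=> hK w; elim: w => //= z u IHu; case: ifP => E; rewrite E ?IHu ?hK.
apply: (@is_tree_autI _ (directed_fun g^-1)) => //.
- exact/K/fun_invK.
- exact/K/inv_funK.
Qed.

Definition ggs_b := AutT (directed_is_aut ggs_a).

Lemma ggs_aE x v : ggs_a (x :: v) = ordS x :: v.
Proof. by []. Qed.

Lemma ggs_b_st1 : st 1 ggs_b.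
Proof.
move=> v; case/tupleP: v => x v; rewrite (tuple0 v) /=.
by case: ifP.
Qed.

Lemma psi_ggs_b (v : 1.-tuple 'I_p) :
  psi ggs_b v = if (thead v).+1 == p then ggs_b else ggs_a.
Proof.
case/tupleP: v => x v; rewrite theadE (tuple0 v).
by apply: autT_eq => w; rewrite /= /section_fun /= drop0; case: ifP.
Qed.

Definition GGS : subgroup autT := generated [set ggs_a; ggs_b].

End Tree.

Arguments GGS p : clear implicits.

(* Main.v *)
Require Import Defs.
From mathcomp Require Import all_boot.
From mathcomp Require Import boolp classical_sets cardinality.

(**
  Write an element of the group as a positive word in a and b, and let N_j
  count the letters b that are followed by exactly j letters modulo p. If K is
  the normal closure of b a^-1, then K / K' is Z[C_p] modulo the norm element,
  and (N_j)_j records the coordinates of a word there. So a relator must have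
  all its N_j equal; this is proved by passing to the sections at the first
  level, which have fewer letters b unless they are powers of b, and satisfy
  N_j(w) = \sum_x N_(j+x+1)(w_x). Moreover \sum_x N_j(w_x) does not depend on j
  as soon as p divides the number of letters b of w, so the N_j also agree on
  every element of rst(1). They differ on every nontrivial power of b a^-1,
  hence rst(1) has infinite index.
*)

Set Implicit Arguments.
Unset Strict Implicit.
Unset Printing Implicit Defensive.

Local Open Scope classical_set_scope.
Local Open Scope group_scope.

Section Words.
Variable p : nat.
Hypothesis p_gt1 : 1 < p.
Local Notation a := (@ggs_a p).
Local Notation b := (@ggs_b p).
Implicit Types (x : 'I_p) (w u : seq bool) (v : word p) (j k : nat).

(** * Positive words and their sections at the first level *)

(* The letter [true] stands for b and [false] for a. *)
Fixpoint ev w : autT p :=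
  if w is c :: w' then (if c then b else a) * ev w' else 1.

Notation na := (count negb).
Notation nb := (count id).

Lemma size_nab w : size w = (na w + nb w)%N.
Proof. by rewrite addnC count_predC. Qed.

Lemma ev_cat w u : ev (w ++ u) = ev w * ev u.
Proof. by elim: w => [|c w IHw] /=; rewrite ?mul1g// IHw mulgA. Qed.

Lemma val_iter_ordS n x : iter n (@ordS p) x = (x + n) %% p :> nat.
Proof.
elim: n => [|n IHn]; first by rewrite addn0 modn_small.
by rewrite iterS /= IHn addnS -addn1 modnDml addn1.
Qed.

Fixpoint sec x w :=
  if w is c :: w' then
    if c then ((iter (na w') (@ordS p) x).+1 == p) :: sec x w' else sec x w'
  else [::].

Lemma ev_cons w x v :
  ev w (x :: v) = iter (na w) (@ordS p) x :: ev (sec x w) v.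
Proof.
elim: w => // -[] w IHw; rewrite [ev _]/= aut_mulE IHw //=.
by case: eqP.
Qed.

Lemma section_ev w x : section (ev w) [:: x] = ev (sec x w).
Proof. by apply: autT_eq => v; rewrite /= /section_fun cat1s ev_cons /= drop0. Qed.

Lemma ev_st1 w : st 1 (ev w) -> p %| na w.
Proof.
move=> /(_ [tuple Ordinal (ltnW p_gt1)]); rewrite ev_cons /= => -[].
by move/(congr1 (@nat_of_ord p)); rewrite val_iter_ordS => /eqP.
Qed.

(** * Distribution of the letters over the sections *)

Lemma size_sec x w : size (sec x w) = nb w.
Proof. by elim: w => //= -[] w IHw; rewrite /= IHw. Qed.

Lemma ex_iter_ordS n :
  exists x0, forall x, ((iter n (@ordS p) x).+1 == p) = (x == x0).
Proof.
have lt_p1 : p.-1 < p by rewrite prednK // ltnW.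
pose y := Ordinal lt_p1; exists (iter n (@ord_pred p) y) => x.
have sK z : iter n (@ordS p) (iter n (@ord_pred p) z) = z.
  by elim: n z => // n IHn z; rewrite iterS [iter n.+1 _ z]iterSr IHn ord_predK.
have pK z : iter n (@ord_pred p) (iter n (@ordS p) z) = z.
  by elim: n {sK} z => // n IHn z; rewrite iterS [iter n.+1 _ z]iterSr IHn ordSK.
by rewrite -[RHS](can_eq pK) sK -val_eqE -[RHS]eqSS /= prednK// ltnW.
Qed.

(** Each b of a word becomes b in exactly one section and a in the others, which collapses the sums
    over [x] below. *)
Lemma sum_last n (F : 'I_p -> nat) :
  exists2 x0, (iter n (@ordS p) x0).+1 = p &
  (\sum_x ((iter n (@ordS p) x).+1 == p) * F x)%N = F x0.
Proof.
have [x0 x0P] := ex_iter_ordS n; exists x0; first by apply/eqP; rewrite x0P.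
rewrite (bigD1 x0)//= x0P eqxx mul1n big1 ?addn0// => x /negPf.
by rewrite x0P => ->; rewrite mul0n.
Qed.

(** The letters a and b agree modulo K, so the tail after a b matters only through its length modulo
    p. *)
Fixpoint N j w : nat :=
  if w is c :: w' then ((c && (size w' == j %[mod p])) + N j w')%N else 0.

Lemma N_mod j k w : j = k %[mod p] -> N j w = N k w.
Proof. by move=> jk; elim: w => //= c w ->; rewrite jk. Qed.

Lemma N_cat j w u : N (j + size u) (w ++ u) = (N j w + N (j + size u) u)%N.
Proof. by elim: w => //= c w ->; rewrite size_cat eqn_modDr addnA. Qed.

(** A b followed by s letters a and t letters b stays b in the section at the x with x + 1 + s = 0
    modulo p, where t letters follow it. There s + t = j amounts to t = j + x + 1 modulo p. *)
Lemma N_sec j w : N j w = (\sum_(x < p) N (j + x.+1) (sec x w))%N.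
Proof.
elim: w => [|c w IHw]; first by rewrite big1.
case: c; rewrite /= IHw //.
rewrite big_split /=; congr addn.
under eq_bigr do rewrite size_sec -mulnb.
have [x0 e ->] := sum_last (na w) (fun x => nb w == j + x.+1 %[mod p] : nat).
rewrite size_nab -(eqn_modDl (x0.+1)) addnA (addnC j).
have /eqP d : (x0.+1 + na w) %% p == 0.
  by rewrite addSn -addn1 -modnDml -val_iter_ordS addn1 e modnn.
by rewrite -modnDml d.
Qed.

(** A b with t letters b to its right has t letters to its right in every section, just as in a
    power of b. *)
Lemma sum_N_sec j w : (\sum_x N j (sec x w))%N = N j (nseq (nb w) true).
Proof.
elim: w => [|c w IHw]; first by rewrite big1.
case: c => //=.
rewrite big_split /= IHw; congr addn.
under eq_bigr do rewrite size_sec -mulnb.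
rewrite size_nseq.
by have [x0 _ ->] := sum_last (na w) (fun=> nb w == j %[mod p] : nat).
Qed.

Lemma sum_nb_sec w : (\sum_x nb (sec x w))%N = nb w.
Proof.
elim: w => [|c w IHw]; first by rewrite big1.
case: c => //=.
rewrite big_split /= IHw; congr addn.
under eq_bigr do rewrite -[nat_of_bool _]muln1.
by have [x0 _ ->] := sum_last (na w) (fun=> 1%N).
Qed.

Definition flat w := forall j k, N j w = N k w.

(** Removing the first or the last letter of b^(k+1) leaves b^k, with indices shifted by one in the
    second case. As p divides k, both removed letters count at index 0. *)
Lemma flat_nseq k : p %| k -> flat (nseq k true).
Proof.
move=> pk; have step j : N j.+1 (nseq k true) = N j (nseq k true).
  have := N_cat j (nseq k true) [:: true].
  rewrite cats1 addn1.
  have -> : rcons (nseq k true) true = nseq k.+1 true.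
    by elim: k {pk} => //= k ->.
  rewrite /= size_nseq addn0 addnC (eqP pk) mod0n; exact: addIn.
have N0 n : N n (nseq k true) = N 0 (nseq k true).
  by elim: n => // n <-; exact: step.
by move=> i j; rewrite !N0.
Qed.

Lemma flat_sec w : (forall x, flat (sec x w)) -> flat w.
Proof. by move=> fw j k; rewrite !N_sec; apply: eq_bigr => x _; exact: fw. Qed.

Lemma section1 x : section (1 : autT p) [:: x] = 1.
Proof. by apply: autT_eq => v; rewrite /= /section_fun /= drop0. Qed.

(** In each section p divides the number of letters a. The p sections have [nb w] letters each, so p
    divides their total number of letters b, which is [nb w]. *)
Lemma dvdn_nb w : ev w = 1 -> p %| nb w.
Proof.
move=> w1; have a_sec x : p %| na (sec x w).
  by apply: ev_st1; rewrite -section_ev w1 section1.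
have : p %| \sum_(x < p) size (sec x w).
  by under eq_bigr do rewrite size_sec; rewrite sum_nat_const card_ord dvdn_mulr.
under eq_bigr do rewrite size_nab.
by rewrite big_split sum_nb_sec dvdn_addr// dvdn_sum.
Qed.

Lemma flat_relator w : ev w = 1 -> flat w.
Proof.
have [n] := ubnP (nb w); elim: n w => // n IHn w /ltnSE le_n w1.
apply: flat_sec => x; have sx1 : ev (sec x w) = 1 by rewrite -section_ev w1 section1.
have le_w : nb (sec x w) <= nb w by rewrite -[leqRHS](size_sec x) count_size.
have [lt_w|ge_w] := ltnP (nb (sec x w)) (nb w).
  exact/IHn/sx1/(leq_trans lt_w).
(* The section has length [nb w] and no fewer letters b, so it is a power of b. *)
suff -> : sec x w = nseq (nb w) true by exact/flat_nseq/dvdn_nb.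
rewrite -(size_sec x); apply/all_pred1P; rewrite -(eq_all (a1 := id)).
  by rewrite all_count eqn_leq count_size size_sec.
by case.
Qed.

Lemma flat_rst w (x0 : 'I_p) :
  (forall x, x != x0 -> ev (sec x w) = 1) -> flat w.
Proof.
move=> w1; have f x : x != x0 -> flat (sec x w) by move=> /w1/flat_relator.
have dvd_w : p %| nb w.
  (* The section at any other letter is a relator of length [nb w]. *)
  have [x xx0] : exists x, x != x0.
    have [e|] := eqVneq (Ordinal (ltnW p_gt1)) x0.
      by exists (Ordinal p_gt1); rewrite -e.
    by exists (Ordinal (ltnW p_gt1)).
  rewrite -(size_sec x) size_nab dvdn_add//; last exact/dvdn_nb/w1.
  by apply: ev_st1; rewrite w1.
apply: flat_sec => x; have [->|] := eqVneq x x0; last exact: f.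
(* The sum over all sections and the terms away from [x0] do not depend on the index, so neither
   does the term at [x0]. *)
move=> j k; have := flat_nseq dvd_w j k; rewrite -!sum_N_sec (bigD1 x0)//=.
rewrite [in RHS](bigD1 x0)//=.
rewrite (eq_bigr (fun x => N k (sec x w))); first by move/addIn.
by move=> y /f; apply.
Qed.

Lemma flat_cat w u : flat w -> flat u -> flat (w ++ u).
Proof.
move=> fw fu; suff e j : N j (w ++ u) = (N 0 w + N 0 u)%N by move=> j k; rewrite !e.
have p0 : 0 < p by exact: ltnW.
(* Adding p times the length of [u] to the index gives the form required by [N_cat]. *)
rewrite (@N_mod _ (j + size u * p.-1 + size u)).
  by rewrite N_cat (fw _ 0) (fu _ 0).
by rewrite -addnA -mulnSr prednK// addnC modnMDl.
Qed.

(** * The group as the set of values of positive words *)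

Lemma ev_nseq_false k : ev (nseq k false) = a ^+ k.
Proof. by elim: k => //= k ->; rewrite expgS. Qed.

Lemma ev_nseq_true k : ev (nseq k true) = b ^+ k.
Proof. by elim: k => //= k ->; rewrite expgS. Qed.

Lemma sec_nseq_false x k : sec x (nseq k false) = [::].
Proof. by elim: k. Qed.

Lemma sec_nseq_true x k : sec x (nseq k true) = nseq k (x.+1 == p).
Proof.
have na0 n : na (nseq n true) = 0%N by elim: n.
by elim: k => //= k ->; rewrite na0.
Qed.

Lemma expg_a : a ^+ p = 1.
Proof.
apply: autT_eq => -[|x v]; rewrite -ev_nseq_false.
  by have [_ -> _] := autP (ev (nseq p false)).
rewrite ev_cons sec_nseq_false; congr (_ :: _); apply: val_inj.
by rewrite /= val_iter_ordS count_nseq mul1n modnDr modn_small.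
Qed.

Lemma expg_b : b ^+ p = 1.
Proof.
apply: autT_eq => v; rewrite -ev_nseq_true.
elim: v => [|x v IHv]; first by have [_ -> _] := autP (ev (nseq p true)).
rewrite ev_cons sec_nseq_true count_nseq mul0n.
by case: eqP => _; rewrite ?IHv// ev_nseq_false expg_a.
Qed.

Lemma ev_inv w : exists u, ev u = (ev w)^-1.
Proof.
have p0 : 0 < p by exact: ltnW.
elim: w => [|c w [u uP]]; first by exists [::]; rewrite invg1.
exists (u ++ nseq p.-1 c); rewrite ev_cat uP /= invgM; congr (_ * _).
apply: (mulIg (if c then b else a)); rewrite mulVg; case: c.
  by rewrite ev_nseq_true -expgSr prednK// expg_b.
by rewrite ev_nseq_false -expgSr prednK// expg_a.
Qed.

Lemma GGS_ev g : sg_set (GGS p) g -> exists w, ev w = g.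
Proof.
move=> /(_ [set g | exists w, ev w = g]); apply.
split; last first.
  by move=> _ [->|->]; [exists [:: false] | exists [:: true]]; rewrite /= mulg1.
split; first by rewrite inE; exists [::].
move=> _ _ /set_mem[w <-] /set_mem[u <-]; apply/mem_set.
by have [u' <-] := ev_inv u; exists (w ++ u'); rewrite ev_cat.
Qed.

Lemma ev_GGS w : sg_set (GGS p) (ev w).
Proof.
have cl := sg_closed (GGS p).
have gen g : [set a; b] g -> g \in sg_set (GGS p).
  by move=> abg; apply/mem_set => H [_ sH]; exact: sH.
suff : ev w \in sg_set (GGS p) by move/set_mem.
elim: w => [|c w IHw] /=; first exact: cl.1.
have cG : (if c then b else a) \in sg_set (GGS p).
  by apply: gen; case: c; [right | left].
by have := group_closedM cl cG IHw; rewrite !inE.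
Qed.

Lemma rst_level1_flat g : rst_level (GGS p) 1 g -> exists2 w, ev w = g & flat w.
Proof.
move=> [h hP <-]; apply: (big_ind (fun g => exists2 w, ev w = g & flat w)).
- by exists [::].
- move=> _ _ [w <- fw] [u <- fu].
  by exists (w ++ u); [rewrite ev_cat | exact: flat_cat].
- move=> v _; have [[/GGS_ev[w <-] _] hv] := hP v; exists w => //.
  apply: (@flat_rst _ (thead v)) => x xv; rewrite -section_ev.
  apply: (hv [tuple x]); apply: contra_neq xv => <-.
  by rewrite theadE.
Qed.

(** * Infinite index of rst(1) *)

(* b a^-1 *)
Definition wc := true :: nseq p.-1 false.

(** Blocks have length p, so each b has p - 1 letters after it modulo p. *)
Lemma N_wc m j : N j (flatten (nseq m wc)) = (m * (p.-1 == j %[mod p]))%N.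
Proof.
have p0 : 0 < p by exact: ltnW.
have N_a k u : N j (nseq k false ++ u) = N j u by elim: k.
have dvd_s k : p %| size (flatten (nseq k wc)).
  elim: k => //= k IHk; rewrite size_cat size_nseq -addSn prednK//.
  by rewrite dvdn_addr.
elim: m => //= m IHm; rewrite mulSn -IHm size_cat size_nseq N_a.
by rewrite -modnDmr (eqP (dvd_s m)) addn0.
Qed.

Lemma ev_wc m : ev (flatten (nseq m wc)) = ev wc ^+ m.
Proof. by elim: m => // m IHm; rewrite expgS -IHm -ev_cat. Qed.

Lemma GGS_not_branch : ~ is_branch (GGS p).
Proof.
case=> _ /(_ 1%N); set R := rst_level _ 1 => fin.
have R1 : R 1.
  exists (fun=> 1); last by rewrite big1.
  move=> v; split; last first.
    by move=> u _; apply: autT_eq => w; rewrite /= /section_fun drop_size_cat.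
  by split=> //; exact: (ev_GGS [::]).
pose f m := [set ev wc ^+ m * h | h in R].
have f_inj : {in [set: nat] &, injective f}.
  move=> i k _ _; wlog le_ik : i k / i <= k.
    by move=> H e; case: (leqP i k) => [/H|/ltnW/H]; [apply | move=> /(_ (esym e))].
  move=> e; move: le_ik; rewrite leq_eqVlt => /orP[/eqP//|lt_ik].
  (* Equal cosets yield a relator (b a^-1)^(k-i) w with w flat. *)
  have : f k (ev wc ^+ i) by rewrite -e; exists 1; rewrite ?mulg1.
  move=> [_ /rst_level1_flat[w <- fw]].
  rewrite -(subnKC (ltnW lt_ik)) expgnDr -mulgA -[RHS]mulg1 => /mulgI.
  rewrite -ev_wc -ev_cat => /flat_relator rel.
  (* At these two indices the power of b a^-1 contributes k - i and 0, and w contributes equally. *)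
  have := rel (p.-1 + size w)%N (0 + size w)%N.
  rewrite !N_cat !N_wc (fw _ 0) (fw (0 + _)%N 0).
  move/addIn/eqP; rewrite eqxx muln1 mod0n modn_small ?prednK ?(ltnW p_gt1)//.
  by rewrite -subn1 subn_eq0 leqNgt p_gt1 muln0 subn_eq0 leqNgt lt_ik.
apply: infinite_nat; rewrite -(eq_finite_set (inj_card_eq f_inj)).
apply: sub_finite_set fin => _ [m _ <-]; exists (ev wc ^+ m) => //.
by rewrite -ev_wc; exact: ev_GGS.
Qed.

End Words.

Theorem theoremC (p : nat) (p_prime : prime p) (p_odd : odd p) :
  ~ is_branch (GGS p).
Proof. exact/GGS_not_branch/prime_gt1. Qed.
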